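(* Let $n\ge 9$ be an odd integer, let $I=\{2,3,\ldots,\frac{n-1}{2}-2\}$, let $\Omega$ be the set of all $\frac{n-1}{2}$-subsets of $[n]$, and for $0\le i\le \frac{n-1}{2}$ let $\Gamma_i=\{(M,M')\in\Omega^2 : |M\cap M'|=i\}$. If the endomorphism monoid $\mathrm{End}\big(J(n,\frac{n-1}{2})_I\big)$ of the merged Johnson graph $J(n,\frac{n-1}{2})_I$ is the symmetric group $S_n$ (acting on $\Omega$ through its natural action on $[n]$) with orbitals $\Gamma_0,\ldots,\Gamma_{\frac{n-1}{2}}$, then the hypergraph $3\text{-}AUQI(n,2)$ is a core.
   Context: $[n]=\{1,\dots,n\}$. The orbitals of a group acting on a set $X$ are its orbits on $X\times X$. A hypergraph $H=(V,E)$ consists of a finite set $V$ of vertices and a set $E$ of non-empty subsets of $V$ (hyperedges) whose union is $V$. A homomorphism $f:H\to H_1$ from $H=(V,E)$ to $H_1=(V_1,E_1)$ is a map $f:V\to V_1$ such that for every $e\in E$ there is $e'\in E_1$ with $f(e)\subseteq e'$ and $|f(e)|=|e|$ (for graphs: the usual graph homomorphisms). An endomorphism is a homomorphism $H\to H$; an automorphism is a bijective endomorphism. A hypergraph is a core if every endomorphism of it is an automorphism. The endomorphism monoid of a graph is the monoid of all its endomorphisms under composition. Definition of $3\text{-}QI(n,2)$ (for $n\ge 8$): its vertices are all binary strings of length $n$ with entries in $\{0,1\}$ whose first entry is $0$ and in which each symbol occurs at least $4$ times; equivalently, the unordered partitions $\{A,\overline{A}\}$ of $[n]$ with $|A|,|\overline{A}|\ge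 4$. Three vertices $v_1,v_2,v_3$ form a hyperedge if and only if for every $(g_1,g_2,g_3)\in\{0,1\}^3$ there is an index $j$ with $v_i[j]=g_i$ for $i=1,2,3$ (equivalently, all eight triple intersections of parts, one part from each partition, are non-empty). For $n$ odd, $3\text{-}AUQI(n,2)$ is the subhypergraph of $3\text{-}QI(n,2)$ induced on the vertices in which one symbol occurs $\frac{n-1}{2}$ times and the other $\frac{n+1}{2}$ times (its hyperedges are all hyperedges of $3\text{-}QI(n,2)$ contained in this vertex set). The merged Johnson graph $J(n,m)_I$ has as vertices all $m$-subsets of $[n]$, with $M,M'$ adjacent iff $|M\cap M'|\in I$. *)

(* Defs.v *)
From HB Require Import structures.
From mathcomp Require Import all_boot all_order all_fingroup.
From mathcomp Require Import zify.

Set Implicit Arguments.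
Unset Strict Implicit.
Unset Printing Implicit Defensive.

Record hypergraph := Hypergraph {
  vertex :> finType;
  hyperedges : {set {set vertex}};
  hyperedges_neq0 : set0 \notin hyperedges;
  cover_hyperedges : cover hyperedges = [set: vertex]
}.

Definition hyper_hom (H H1 : hypergraph) (f : H -> H1) : Prop :=
  forall e, e \in hyperedges H ->
  exists2 e', e' \in hyperedges H1 & (f @: e \subset e') /\ #|f @: e| = #|e|.

Definition hyper_endo (H : hypergraph) (f : H -> H) : Prop := hyper_hom f.

Definition hyper_auto (H : hypergraph) (f : H -> H) : Prop :=
  bijective f /\ hyper_endo f.

Definition hyper_core (H : hypergraph) : Prop :=
  forall f : H -> H, hyper_endo f -> hyper_auto f.

(* The hyperedges of H contained in S, as sets of elements of the subtype S. *)
Definition induced_edges (H : hypergraph) (S : {set H}) :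
    {set {set {x : H | x \in S}}} :=
  [set e : {set {x : H | x \in S}} | val @: e \in hyperedges H].

Lemma induced_edges_neq0 (H : hypergraph) (S : {set H}) :
  set0 \notin induced_edges S.
Proof. by rewrite inE imset0 hyperedges_neq0. Qed.

(* Vertices of S may lie in no hyperedge contained in S, hence the premise. *)
Definition induced_hypergraph (H : hypergraph) (S : {set H})
    (covS : cover (induced_edges S) = [set: {x : H | x \in S}]) : hypergraph :=
  Hypergraph (induced_edges_neq0 S) covS.

(* The symbols 0 and 1 are false and true. *)
Definition is_qi_vertex (n : nat) (v : n.-tuple bool) : bool :=
  ~~ head false v && [forall b : bool, 4 <= count_mem b v].

Definition qi_vertex (n : nat) := {v : n.-tuple bool | is_qi_vertex v}.

Definition qualitatively_independent (n : nat) (v1 v2 v3 : n.-tuple bool) : bool :=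
  [forall g1 : bool, forall g2 : bool, forall g3 : bool, exists j : 'I_n,
    [&& tnth v1 j == g1, tnth v2 j == g2 & tnth v3 j == g3]].

Definition qi_edges (n : nat) : {set {set qi_vertex n}} :=
  [set e : {set qi_vertex n} | [exists v1, exists v2, exists v3,
     (e == [set v1; v2; v3]) &&
     qualitatively_independent (val v1) (val v2) (val v3)]].

(* The vertices in which one symbol occurs (n-1)/2 times and the other
   (n+1)/2 times. *)
Definition auqi_vertices (n : nat) : {set qi_vertex n} :=
  [set v : qi_vertex n | [exists b : bool,
     (count_mem b (val v) == n.-1./2) && (count_mem (~~ b) (val v) == n.+1./2)]].

Lemma qi_edges_neq0 (n : nat) : set0 \notin qi_edges n.
Proof.
rewrite inE; apply/negP=> /existsP[v1 /existsP[v2 /existsP[v3 /andP[/eqP e0 _]]]].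
by have := in_set0 v1; rewrite e0 !inE eqxx.
Qed.

(* Position j of s is labelled (b, k) with b = s[j] and k the number of earlier
   occurrences of b. Reading off the two low bits of k gives two strings that
   form a hyperedge with s. *)
Definition ranks (s : seq bool) : seq (bool * nat) :=
  [seq (nth false s i, count_mem (nth false s i) (take i s))
     | i <- iota 0 (size s)].

Lemma size_ranks s : size (ranks s) = size s.
Proof. by rewrite size_map size_iota. Qed.

Lemma ranks_rcons s b : ranks (rcons s b) = rcons (ranks s) (b, count_mem b s).
Proof.
rewrite /ranks size_rcons -addn1 iotaD map_cat add0n /= cats1.
congr rcons; last by rewrite nth_rcons ltnn eqxx -cats1 take_size_cat.
apply/eq_in_map => i; rewrite mem_iota add0n /= => lt_i.
by rewrite nth_rcons lt_i -cats1 takel_cat // ltnW.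
Qed.

Lemma count_ranks (P : pred nat) (b : bool) (s : seq bool) :
  count (fun p => (p.1 == b) && P p.2) (ranks s)
    = count P (iota 0 (count_mem b s)).
Proof.
elim/last_ind: s => [|s c IH] //.
rewrite ranks_rcons -!cats1 !count_cat IH /= !addn0.
case: eqVneq => [->|_] /=; last by rewrite !addn0.
by rewrite iotaD count_cat /= addn0.
Qed.

Lemma count_ranks_split (P : bool -> pred nat) (s : seq bool) :
  count (fun p => P p.1 p.2) (ranks s)
    = count (P true) (iota 0 (count_mem true s))
      + count (P false) (iota 0 (count_mem false s)).
Proof.
rewrite -!count_ranks; elim: (ranks s) => [|[[] k] r IH] //=; rewrite IH.
  by rewrite addnA.
by rewrite addnCA.
Qed.

Definition low_bit (p : bool * nat) := odd p.2.
Definition high_bit (p : bool * nat) := odd p.2./2 (+) p.1.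

Lemma count_low k : count odd (iota 0 k) = k./2.
Proof.
elim: k => // k IH; rewrite -[k.+1]addn1 iotaD count_cat IH /= add0n addn0 addn1.
by rewrite /= uphalf_half addnC.
Qed.

Lemma count_high k :
  count (fun i => odd i./2) (iota 0 k) = (k %/ 4).*2 + (k %% 4 == 3).
Proof.
elim: k => // k IH; rewrite -addn1 iotaD count_cat IH /= add0n addn0.
have -> : odd k./2 = (2 <= k %% 4) by lia.
have := ltn_pmod k (isT : 0 < 4); rewrite addn1.
case E : (k %% 4) => [|[|[|[|m]]]] //= _; lia.
Qed.

Lemma count_mem_bool (b : bool) (s : seq bool) :
  count_mem b s + count_mem (~~ b) s = size s.
Proof. by elim: s => [|[] s /=]; case: b => /=; lia. Qed.

Lemma count_map_bool (f : bool * nat -> bool) (s : seq bool) :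
  count_mem true (map f (ranks s))
    = count (fun k => f (true, k)) (iota 0 (count_mem true s))
      + count (fun k => f (false, k)) (iota 0 (count_mem false s)).
Proof.
rewrite -(count_ranks_split (fun b k => f (b, k))) count_map.
by apply: eq_count => -[b k] /=; rewrite eqb_id.
Qed.

Lemma count_map_low (s : seq bool) :
  count_mem true (map low_bit (ranks s))
    = (count_mem true s)./2 + (count_mem false s)./2.
Proof. by rewrite count_map_bool -!count_low. Qed.

Lemma count_map_high (s : seq bool) (k := count_mem true s)
    (l := count_mem false s) :
  count_mem true (map high_bit (ranks s)) + ((k %/ 4).*2 + (k %% 4 == 3))
    = k + ((l %/ 4).*2 + (l %% 4 == 3)).
Proof.
rewrite count_map_bool -!count_high -/k -/l.
have := count_predC (fun i => odd i./2) (iota 0 k); rewrite size_iota.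
rewrite (@eq_count _ (fun i => high_bit (true, i)) (predC (fun i => odd i./2))).
  rewrite (@eq_count _ (fun i => high_bit (false, i)) (fun i => odd i./2)).
    by move=> {3}<-; lia.
  by move=> i; rewrite /high_bit /= addbF.
by move=> i; rewrite /high_bit /= addbT.
Qed.

Lemma partners_independent n (v : n.-tuple bool)
    (ul : size (map low_bit (ranks v)) == n)
    (uh : size (map high_bit (ranks v)) == n) :
  [forall b : bool, 4 <= count_mem b v] ->
  qualitatively_independent v (Tuple ul) (Tuple uh).
Proof.
move/forallP=> v4; apply/forallP=> g1; apply/forallP=> g2; apply/forallP=> g3.
pose P k := (odd k == g2) && (odd k./2 (+) g1 == g3).
have /(has_nthP (false, 0))[i] :
    has (fun p => (p.1 == g1) && P p.2) (ranks v).
  rewrite has_count count_ranks -(subnKC (v4 g1)) iotaD count_cat.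
  by apply: ltn_addr; rewrite /P; case: (g1) (g2) (g3) => [] [] [].
rewrite size_ranks => lt_i; rewrite /P => /and3P[e1 e2 e3].
have lt_in : i < n by rewrite -(size_tuple v).
have i1 : (nth (false, 0) (ranks v) i).1 = nth false v i.
  by rewrite /ranks (nth_map 0) ?size_iota // nth_iota.
apply/existsP; exists (Ordinal lt_in); rewrite !(tnth_nth false) /=.
rewrite !(nth_map (false, 0)) ?size_ranks // -i1 e1 /low_bit e2 /=.
by rewrite /high_bit (eqP e1).
Qed.

Lemma low_arith n k l a b :
  4 <= k -> 4 <= l -> k + l = n -> a + b = n -> a = k./2 + l./2 ->
  [/\ 4 <= a, 4 <= b & odd n -> a = n.-1./2 /\ b = n.+1./2].
Proof. by split; lia. Qed.

Lemma high_arith n k l a b :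
  4 <= k -> 4 <= l -> k + l = n -> a + b = n ->
  a + ((k %/ 4).*2 + (k %% 4 == 3)) = k + ((l %/ 4).*2 + (l %% 4 == 3)) ->
  [/\ 4 <= a, 4 <= b & odd n -> k = l.+1 \/ l = k.+1 ->
    (a = n.-1./2 /\ b = n.+1./2) \/ (b = n.-1./2 /\ a = n.+1./2)].
Proof. by split; lia. Qed.

Lemma qi_partners n (v : qi_vertex n) :
  exists u w : qi_vertex n, qualitatively_independent (val v) (val u) (val w)
    /\ (odd n -> v \in auqi_vertices n ->
        u \in auqi_vertices n /\ w \in auqi_vertices n).
Proof.
case: v => v vP; have /andP[v0 v4] := vP.
have sz (f : bool * nat -> bool) : size (map f (ranks v)) == n.
  by rewrite size_map size_ranks size_tuple.
have ind := partners_independent (sz low_bit) (sz high_bit) v4.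
have kv := forallP v4 true; have lv := forallP v4 false.
have sum (t : seq bool) : size t == n -> count_mem true t + count_mem false t = n.
  by move/eqP <-; exact: (count_mem_bool true).
have vn := sum _ (introT eqP (size_tuple v)).
have [lT lF lB] := low_arith kv lv vn (sum _ (sz low_bit)) (count_map_low v).
have [hT hF hB] := high_arith kv lv vn (sum _ (sz high_bit)) (count_map_high v).
have low_head : ~~ head false (map low_bit (ranks v)).
  by case: (tval v) => [|[]].
have high_head : ~~ head false (map high_bit (ranks v)).
  by move: v0; case: (tval v) => [|[]].
have uP : is_qi_vertex (Tuple (sz low_bit)).
  rewrite /is_qi_vertex low_head /=; by apply/forallP => -[].
have wP : is_qi_vertex (Tuple (sz high_bit)).
  rewrite /is_qi_vertex high_head /=; by apply/forallP => -[].
exists (Sub (Tuple (sz low_bit)) uP : qi_vertex n).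
exists (Sub (Tuple (sz high_bit)) wP : qi_vertex n); split=> // on.
rewrite !inE /= => /existsP[b /andP[/eqP b1 /eqP b2]].
split; apply/existsP.
  by have [e1 e2] := lB on; exists true; apply/andP; split; apply/eqP.
have [|[e1 e2]|[e1 e2]] := hB on.
- by case: b b1 b2 => /= b1 b2; move: b1 b2 vn on;
    move: (count_mem true v) (count_mem false v) => k l; lia.
- by exists true; apply/andP; split; apply/eqP.
- by exists false; apply/andP; split; apply/eqP.
Qed.

Lemma cover_qi_edges (n : nat) : cover (qi_edges n) = [set: qi_vertex n].
Proof.
apply/setP=> v; rewrite inE; have [u [w [ind _]]] := qi_partners v.
apply/bigcupP; exists [set v; u; w]; last by rewrite !inE eqxx.
rewrite inE; apply/existsP; exists v; apply/existsP; exists u.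
by apply/existsP; exists w; rewrite eqxx.
Qed.

(* 3-QI(n,2); of interest for n >= 8, and without vertices for n < 8. *)
Definition QI3 (n : nat) : hypergraph :=
  Hypergraph (qi_edges_neq0 n) (cover_qi_edges n).

Lemma cover_auqi_edges (n : nat) (on : odd n) :
  cover (@induced_edges (QI3 n) (auqi_vertices n))
    = [set: {x : QI3 n | x \in auqi_vertices n}].
Proof.
apply/setP=> -[v vA]; rewrite inE; have [u [w [ind /(_ on vA)[uA wA]]]] := qi_partners v.
apply/bigcupP; pose V (x : QI3 n) xA : {x : QI3 n | x \in auqi_vertices n} := exist _ x xA.
exists [set V v vA; V u uA; V w wA]; last by rewrite !inE eqxx.
rewrite !inE; apply/existsP; exists v; apply/existsP; exists u.
by apply/existsP; exists w; rewrite !imsetU !imset_set1 eqxx.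
Qed.

(* 3-AUQI(n,2), for n odd *)
Definition AUQI3 (n : nat) (on : odd n) : hypergraph :=
  @induced_hypergraph (QI3 n) (auqi_vertices n) (cover_auqi_edges on).

(* The endomorphism monoid, as a set of self-maps of the vertex set. *)
Definition graph_End (T : finType) (e : rel T) : {set {ffun T -> T}} :=
  [set f : {ffun T -> T} | [forall x, forall y, e x y ==> e (f x) (f y)]].

Definition ksubset (n m : nat) := {M : {set 'I_n} | #|M| == m}.

Definition merged_johnson (n m : nat) (I : pred nat) : rel (ksubset n m) :=
  fun M M' => I #|val M :&: val M'|.

Lemma ksubset_perm_proof (n m : nat) (M : ksubset n m) (s : 'S_n) :
  #|s @: val M| == m.
Proof. by rewrite card_imset ?(valP M) //; apply: perm_inj. Qed.

Definition ksubset_perm (n m : nat) (M : ksubset n m) (s : 'S_n) : ksubset n m :=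
  exist _ (s @: val M) (ksubset_perm_proof M s).

Lemma ksubset_perm1 (n m : nat) (M : ksubset n m) : ksubset_perm M 1%g = M.
Proof.
apply: val_inj => /=; rewrite -[RHS]imset_id.
by apply: eq_imset => i; rewrite perm1.
Qed.

Lemma ksubset_permM (n m : nat) (M : ksubset n m) (s t : 'S_n) :
  ksubset_perm M (s * t)%g = ksubset_perm (ksubset_perm M s) t.
Proof.
apply: val_inj => /=; rewrite -imset_comp.
by apply: eq_imset => i; rewrite permM.
Qed.

(* The natural action of S_n on the m-subsets of {0, ..., n-1}. *)
Definition ksubset_action (n m : nat) : {action 'S_n &-> ksubset n m} :=
  TotalAction (@ksubset_perm1 n m) (@ksubset_permM n m).

(* The group G as a set of self-maps of the set it acts on. *)
Definition action_maps (aT : finGroupType) (T : finType)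
    (to : {action aT &-> T}) (G : {group aT}) : {set {ffun T -> T}} :=
  [set [ffun x => to x a] | a in G].

Definition orbitals (aT : finGroupType) (T : finType)
    (to : {action aT &-> T}) (G : {group aT}) : {set {set T * T}} :=
  [set [set (to p.1 a, to p.2 a) | a in G] | p : T * T].

Definition Gamma (n m i : nat) : {set ksubset n m * ksubset n m} :=
  [set p | #|val p.1 :&: val p.2| == i].

(* Main.v *)
Require Import Defs.
From mathcomp Require Import all_boot all_order all_fingroup.
From mathcomp Require Import zify.

Set Implicit Arguments.
Unset Strict Implicit.
Unset Printing Implicit Defensive.

(** Write m = (n-1)/2.  A vertex of 3-AUQI(n,2) is a partition of [n] into
    parts of sizes m and m+1, so it is the same thing as its smaller part, an
    m-subset ([minority_block], with inverse [vertex_of]).  The key point is that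
    two distinct vertices lie in a common hyperedge exactly when the
    corresponding m-subsets M, N are adjacent in J(n,m)_I.

    - If three partitions are independent, the third one splits each of the four
      cells M&N, M\N, N\M and the complement of the union into two non-empty
      pieces, so all four cells have at least two elements
      ([independent3_cells]).  The cells have sizes i, m-i, m-i, i+1 with
      i = |M&N|, so this says 2 <= i <= m-2 ([cells_johnson]).
    - Conversely, if all four cells have at least two elements, choose in each
      cell one element to be put in C and another one to be kept out of C.  This
      constrains at most eight elements, four on each side, and since
      4 <= m <= n-4 such a C of size exactly m exists ([cells_independent3]).

    An endomorphism of the hypergraph preserves the size of hyperedges, so it is
    injective on each of them and maps vertices sharing a hyperedge to distinct
    vertices sharing a hyperedge.  Read on m-subsets it is therefore an
    endomorphism of J(n,m)_I, hence by hypothesis it is induced by a permutation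
    of [n]; in particular it is a bijection. *)

(** * Splitting the cells of two partitions *)

Lemma subset_interpolation (T : finType) (A B : {set T}) k :
  A \subset B -> #|A| <= k <= #|B| ->
  exists C : {set T}, [/\ A \subset C, C \subset B & #|C| = k].
Proof.
elim: k => [|k IH] AB /andP[Ak kB].
  by exists A; split=> //; apply/eqP; rewrite -leqn0.
rewrite leq_eqVlt in Ak; case/orP: Ak => [/eqP Ak|Ak]; first by exists A.
have [|C [AC CB Ck]] := IH AB; first by rewrite -ltnS Ak ltnW.
have /properP[_ [z zB zC]] : C \proper B by rewrite properEcard CB Ck.
exists (z |: C); split; last by rewrite cardsU1 zC Ck.
- exact: subset_trans AC (subsetUr _ _).
- by rewrite subUset sub1set zB.
Qed.

(** Two-part partitions are handled as boolean functions on an arbitrary finite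
    type; exchanging the names of the two parts is then adding a constant with
    [addb], which is how strings and m-subsets are compared below. *)
Definition independent3 (T : finType) (x y z : T -> bool) :=
  forall a b c, exists j, [/\ x j = a, y j = b & z j = c].

Lemma qualitatively_independentP n (v1 v2 v3 : n.-tuple bool) :
  reflect (independent3 (tnth v1) (tnth v2) (tnth v3))
          (qualitatively_independent v1 v2 v3).
Proof.
apply: (iffP forallP) => [ind a b c|ind a].
  have /forallP/(_ b)/forallP/(_ c)/existsP[j /and3P[]] := ind a.
  by move=> /eqP ? /eqP ? /eqP ?; exists j.
apply/forallP=> b; apply/forallP=> c; apply/existsP.
by have [j [xj yj zj]] := ind a b c; exists j; rewrite xj yj zj !eqxx.
Qed.

Lemma independent3_rotate (T : finType) (x y z : T -> bool) :
  independent3 x y z -> independent3 y z x.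
Proof. by move=> ind a b c; have [j []] := ind c a b; exists j. Qed.

Lemma independent3_swap (T : finType) (x y z : T -> bool) :
  independent3 x y z -> independent3 y x z.
Proof. by move=> ind a b c; have [j []] := ind b a c; exists j. Qed.

Definition cell (T : finType) (x y : T -> bool) a b :=
  [set j | (x j == a) && (y j == b)].

Definition cells_gt1 (T : finType) (x y : T -> bool) :=
  forall a b, 1 < #|cell x y a b|.

(** The third partition separates two elements of each cell of the first two. *)
Lemma independent3_cells (T : finType) (x y z : T -> bool) :
  independent3 x y z -> cells_gt1 x y.
Proof.
move=> ind a b; apply/card_gt1P.
have [i [xi yi zi]] := ind a b true; have [j [xj yj zj]] := ind a b false.
exists i, j; rewrite !inE xi yi xj yj !eqxx; split=> //.
by apply: contra_eq_neq zi => ->; rewrite zj.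
Qed.

(** With one element of each cell forced into C and another one forced out, any
    cardinality between 4 and #|T| - 4 remains possible for C. *)
Lemma cells_independent3 (T : finType) (x y : T -> bool) k :
  cells_gt1 x y -> 4 <= k -> k + 4 <= #|T| ->
  exists2 C : {set T}, #|C| = k & independent3 x y (mem C).
Proof.
move=> big k4 kT.
have /fin_all_exists[pq pqP] (c : bool * bool) : exists r : T * T,
    [/\ r.1 \in cell x y c.1 c.2, r.2 \in cell x y c.1 c.2 & r.1 != r.2].
  by have /card_gt1P[p [q ?]] := big c.1 c.2; exists (p, q).
pose P := [set (pq c).1 | c : bool * bool].
pose Q := [set (pq c).2 | c : bool * bool].
have card4 : #|{: bool * bool}| = 4 by rewrite card_prod card_bool.
have P4 : #|P| <= 4 by rewrite -card4 leq_imset_card.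
have Q4 : #|Q| <= 4 by rewrite -card4 leq_imset_card.
have PQ : P \subset ~: Q.
  (* A point chosen twice would determine its cell, hence the pair it is in. *)
  apply/subsetP=> _ /imsetP[[a b] _ ->]; rewrite inE; apply/imsetP=> -[[c d] _].
  have := pqP (a, b); have := pqP (c, d); rewrite !inE /=.
  case=> _ /andP[/eqP xq /eqP yq] _ [/andP[/eqP xp /eqP yp] _ pNq] e.
  rewrite -e xp in xq; rewrite -e yp in yq.
  by move: pNq; rewrite -xq -yq in e *; rewrite e eqxx.
have [|C [PC CQ Ck]] := @subset_interpolation _ P (~: Q) k PQ.
  by have := cardsC Q; lia.
exists C => // a b c; have := pqP (a, b); rewrite !inE /=.
case=> /andP[/eqP xp /eqP yp] /andP[/eqP xq /eqP yq] _.
case: c; first by exists (pq (a, b)).1; split=> //; apply/(subsetP PC)/imset_f.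
exists (pq (a, b)).2; split=> //; apply/negbTE/negP=> /(subsetP CQ).
by rewrite inE => /negP; apply; apply: imset_f.
Qed.

Lemma independent3_edge (V T : finType) (s : V -> T -> bool) v1 v2 v3 x y :
  independent3 (s v1) (s v2) (s v3) ->
  x \in [set v1; v2; v3] -> y \in [set v1; v2; v3] -> x != y ->
  cells_gt1 (s x) (s y).
Proof.
move=> i123; have i231 := independent3_rotate i123.
have i312 := independent3_rotate i231.
have i213 := independent3_swap i123; have i321 := independent3_swap i231.
have i132 := independent3_swap i312.
have cells := @independent3_cells T.
rewrite !inE => /orP[/orP[]|] /eqP-> /orP[/orP[]|] /eqP->; rewrite ?eqxx // => _;
  by apply: cells; eassumption.
Qed.

Lemma cells_gt1_flip (T : finType) (x y x' y' : T -> bool) c d :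
  (forall j, x' j = x j (+) c) -> (forall j, y' j = y j (+) d) ->
  cells_gt1 x y -> cells_gt1 x' y'.
Proof.
move=> xc yd big a b; rewrite (_ : cell _ _ _ _ = cell x y (a (+) c) (b (+) d)) //.
apply/setP=> j; rewrite !inE xc yd.
by rewrite -[x j == _](can_eq (addbK c)) -[y j == _](can_eq (addbK d)) !addbK.
Qed.

Lemma independent3_flip (T : finType) (x y z x' y' z' : T -> bool) c d e :
  (forall j, x' j = x j (+) c) -> (forall j, y' j = y j (+) d) ->
  (forall j, z' j = z j (+) e) ->
  independent3 x y z -> independent3 x' y' z'.
Proof.
move=> xc yd ze ind a b f.
have [j [xj yj zj]] := ind (a (+) c) (b (+) d) (f (+) e).
by exists j; rewrite xc yd ze xj yj zj !addbK.
Qed.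

Lemma card_tnth n (v : n.-tuple bool) b :
  #|[set j | tnth v j == b]| = count_mem b v.
Proof.
rewrite -sum1_count big_tuple -sum1_card; apply: eq_bigl => j.
by rewrite inE.
Qed.

(** For i = #|M :&: N| the four cells have i, m - i, m - i and i + 1 elements. *)
Lemma cells_johnson n m (M N : ksubset n m) :
  n = m.*2.+1 ->
  cells_gt1 (mem (val M)) (mem (val N)) <->
  2 <= #|val M :&: val N| <= m - 2.
Proof.
move=> nE; have cM := eqP (valP M); have cN := eqP (valP N).
have cC a b : #|cell (mem (val M)) (mem (val N)) a b| =
    #|(if a then val M else ~: val M) :&: (if b then val N else ~: val N)|.
  by apply: eq_card => j; case: a b => [] []; rewrite !inE /=; do 2!case: (j \in _).
have e1 := cardsID (val N) (val M); have e2 := cardsID (val M) (val N).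
have e3 := cardsID (val N) (~: val M); have e4 := cardsC (val M).
rewrite !setDE card_ord in e1 e2 e3 e4.
rewrite (setIC _ (val M)) (setIC _ (~: val M)) in e2.
split=> [big|MN a b].
  by have := big true true; have := big true false; rewrite !cC; lia.
by rewrite cC; case: a b => [] []; lazy iota; lia.
Qed.

(** * Vertices of 3-AUQI(n,2) as subsets of size (n-1)/2 *)

Section Dictionary.

Variables (n : nat) (n_odd : odd n).
Let m := n.-1./2.

Lemma odd_pred_half : n = m.*2.+1.
Proof. by rewrite /m; lia. Qed.

Definition symbols (x : AUQI3 n_odd) : 'I_n -> bool := tnth (val (val x)).

Lemma symbols_inj x y : symbols x =1 symbols y -> x = y.
Proof. by move=> e; do 2!apply: val_inj; apply: eq_from_tnth. Qed.

Lemma auqi_edgeP (e : {set AUQI3 n_odd}) :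
  reflect (exists v1 v2 v3, e = [set v1; v2; v3] /\
             independent3 (symbols v1) (symbols v2) (symbols v3))
          (e \in hyperedges (AUQI3 n_odd)).
Proof.
rewrite !inE; apply: (iffP idP) => [|[v1 [v2 [v3 [-> ind]]]]]; last first.
  apply/existsP; exists (val v1); apply/existsP; exists (val v2).
  apply/existsP; exists (val v3); rewrite !imsetU !imset_set1 eqxx.
  exact/qualitatively_independentP.
case/existsP=> v1 /existsP[v2 /existsP[v3 /andP[/eqP eE ind]]].
have lift_v v : v \in [set v1; v2; v3] -> exists x : AUQI3 n_odd, val x = v.
  by rewrite -eE => /imsetP[x _ ->]; exists x.
have [|x1 e1] := lift_v v1; first by rewrite !inE eqxx.
have [|x2 e2] := lift_v v2; first by rewrite !inE eqxx orbT.
have [|x3 e3] := lift_v v3; first by rewrite !inE eqxx orbT.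
exists x1, x2, x3; split; last first.
  by apply/qualitatively_independentP; rewrite e1 e2 e3.
by apply: (imset_inj val_inj); rewrite eE !imsetU !imset_set1 e1 e2 e3.
Qed.

(** As n is odd, the two symbols do not occur equally often, and the rarer one
    occurs exactly m times. *)
Definition minority (x : AUQI3 n_odd) : bool :=
  count_mem true (val (val x)) == m.

Lemma minority_count x : count_mem (minority x) (val (val x)) = m.
Proof.
have := valP x; rewrite inE /minority => /existsP[b /andP[/eqP c1 /eqP c2]].
by case: b c1 c2 => /= c1 c2; case: eqP => //; rewrite -/m in c1; lia.
Qed.

Lemma minority_blockP x : #|[set j | symbols x j == minority x]| == m.
Proof. by rewrite card_tnth minority_count. Qed.

Definition minority_block (x : AUQI3 n_odd) : ksubset n m :=
  exist (fun M : {set 'I_n} => #|M| == m) _ (minority_blockP x).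

Lemma minority_blockE x j :
  (j \in val (minority_block x)) = symbols x j (+) ~~ minority x.
Proof. by rewrite inE; case: (symbols x j) (minority x) => [] []. Qed.

(** The string of a vertex starts with false, so it is the characteristic string
    of the minority block up to a complementation that is needed exactly when
    the block contains the first element; it is decided by [has_first], which
    makes sense without assuming 0 < n. *)
Definition has_first (M : {set 'I_n}) := [exists j in M, val j == 0].

Definition indicator (M : {set 'I_n}) : n.-tuple bool :=
  [tuple (j \in M) (+) has_first M | j < n].

Lemma has_firstE (M : {set 'I_n}) (j : 'I_n) :
  val j = 0 -> has_first M = (j \in M).
Proof.
move=> j0; apply/existsP/idP => [[i /andP[iM /eqP i0]]|jM].
  by rewrite (_ : j = i) //; apply: val_inj; rewrite j0 i0.
by exists j; rewrite jM j0.
Qed.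

Lemma indicator_count (M : ksubset n m) b :
  count_mem b (indicator (val M)) = if b (+) has_first (val M) then m else m.+1.
Proof.
have nE := odd_pred_half; have cM := eqP (valP M).
have := cardsC (val M); rewrite cM card_ord => cCM.
rewrite -card_tnth; set d := has_first _.
rewrite (_ : [set _ | _] = if b (+) d then val M else ~: val M).
  by case: ifP => _ //; apply: (@addnI m); rewrite cCM addnS addnn.
apply/setP=> j; rewrite inE tnth_mktuple -/d.
by case: b d => [] []; rewrite /= ?inE; case: (j \in _).
Qed.

Hypothesis n_ge9 : 9 <= n.

Lemma indicator_qi (M : ksubset n m) : is_qi_vertex (indicator (val M)).
Proof.
have nE := odd_pred_half; apply/andP; split; last first.
  by apply/forallP=> b; rewrite indicator_count; case: ifP => _; lia.
have n0 : 0 < n by lia.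
rewrite -nth0 -[0]/(val (Ordinal n0)) -tnth_nth tnth_mktuple.
by rewrite (@has_firstE _ (Ordinal n0)) // addbb.
Qed.

Lemma indicator_auqi (M : ksubset n m) :
  (exist (@is_qi_vertex n) _ (indicator_qi M) : qi_vertex n) \in auqi_vertices n.
Proof.
have nE := odd_pred_half; rewrite inE; apply/existsP; exists (~~ has_first (val M)).
rewrite /= negbK !indicator_count addNb addbb eqxx -/m /=.
by apply/eqP; lia.
Qed.

Definition vertex_of (M : ksubset n m) : AUQI3 n_odd :=
  exist (fun v : QI3 n => v \in auqi_vertices n) _ (indicator_auqi M).

Lemma symbols_vertex_of M j :
  symbols (vertex_of M) j = mem (val M) j (+) has_first (val M).
Proof. exact: tnth_mktuple. Qed.

Lemma minority_blockK : cancel minority_block vertex_of.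
Proof.
move=> x; apply: symbols_inj => j.
have n0 : 0 < n by lia.
have /andP[h0 _] := valP (val x).
rewrite symbols_vertex_of (@has_firstE _ (Ordinal n0)) //= !minority_blockE.
have /negbTE -> : ~~ symbols x (Ordinal n0) by rewrite /symbols (tnth_nth false) nth0.
by rewrite addFb -addbA addbb addbF.
Qed.

(** * Sharing a hyperedge is adjacency in the merged Johnson graph *)

(** A third block of size m exists because n >= 9 gives 4 <= m and m + 4 <= n.
    Distinctness is recorded because only distinct vertices of a hyperedge are
    sure to have distinct images. *)
Lemma johnson_edge (M N : ksubset n m) :
  2 <= #|val M :&: val N| <= m - 2 ->
  exists2 e, e \in hyperedges (AUQI3 n_odd)
           & [/\ vertex_of M \in e, vertex_of N \in e & vertex_of M != vertex_of N].
Proof.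
have nE := odd_pred_half => /(cells_johnson M N nE) cells.
have [||C /eqP cC indC] := cells_independent3 (k := m) cells.
- by lia.
- by rewrite card_ord; lia.
pose K : ksubset n m := exist _ C cC.
have ind : independent3 (symbols (vertex_of M)) (symbols (vertex_of N))
                        (symbols (vertex_of K)).
  by apply: independent3_flip indC; apply: symbols_vertex_of.
exists [set vertex_of M; vertex_of N; vertex_of K].
  by apply/auqi_edgeP; exists (vertex_of M), (vertex_of N), (vertex_of K).
rewrite !inE !eqxx orbT; split=> //; apply/eqP=> eMN.
by have [j [Mj Nj _]] := ind true false true; rewrite eMN Nj in Mj.
Qed.

Lemma edge_johnson e x y :
  e \in hyperedges (AUQI3 n_odd) -> x \in e -> y \in e -> x != y ->
  2 <= #|val (minority_block x) :&: val (minority_block y)| <= m - 2.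
Proof.
case/auqi_edgeP=> v1 [v2 [v3 [-> ind]]] xe ye xNy.
apply/(cells_johnson _ _ odd_pred_half).
by apply: cells_gt1_flip (independent3_edge ind xe ye xNy); apply: minority_blockE.
Qed.

End Dictionary.

(** * The core property *)

Theorem corollary2 (n : nat) (n_ge9 : 9 <= n) (n_odd : odd n)
    (m := n.-1./2)
    (I : pred nat := fun i => 2 <= i <= m - 2)
    (End_Sn : graph_End (@merged_johnson n m I)
                = action_maps (ksubset_action n m) [set: 'S_n]%G)
    (orbitals_Sn : orbitals (ksubset_action n m) [set: 'S_n]%G
                     = [set Gamma n m (i : nat) | i : 'I_m.+1]) :
  hyper_core (AUQI3 n_odd).
Proof.
move=> f f_endo; split=> //; apply: injF_bij.
pose g := [ffun M => minority_block (f (vertex_of n_odd n_ge9 M))].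
(* f seen as a self-map of the m-subsets is a graph endomorphism. *)
have : g \in graph_End (@merged_johnson n m I).
  rewrite inE; apply/forallP=> M; apply/forallP=> N; apply/implyP=> MN.
  have [e eE [Me Ne vMN]] := johnson_edge n_odd n_ge9 MN.
  have [e' e'E [fe_e' /eqP/imset_injP f_inj]] := f_endo e eE.
  rewrite /merged_johnson !ffunE; apply: (edge_johnson e'E).
  - exact/(subsetP fe_e')/imset_f.
  - exact/(subsetP fe_e')/imset_f.
  - by apply: contra_neq vMN; apply: f_inj.
rewrite End_Sn => /imsetP[s _ gE] x y fxy.
apply: (can_inj (minority_blockK n_ge9)).
apply: (act_inj (ksubset_action n m) s).
have gs M : ksubset_action n m M s = g M by rewrite gE ffunE.
by rewrite !gs !ffunE !minority_blockK fxy.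
Qed.
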